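(* Let $U_i^m=u(x_i,t_m)$, where $u$ is the solution of the time-space fractional diffusion problem in the context, and let $\{u_i^m\mid 0\le i\le N,\ 0\le m\le M\}$ be the solution of the fast implicit difference scheme (FIDS) in the context. Put $e_i^m=U_i^m-u_i^m$. Let $p\in(0,2]$ (determined by the spatial regularity of $u$) and $c_2>0$ be the order and constant in the local truncation error bound stated in the context. There is a constant $c_1>0$, depending on the problem ($\gamma$, $T$ and the fixed grading exponent $r$) but not on $M,N$, such that if $\epsilon\le\min\{c_1M^\gamma,\tfrac12T^{-\gamma}\}$, then $$\|\boldsymbol e^m\|_\infty\le 2\,\Gamma(1-\gamma)\,c_2\,T^\gamma\big(M^{-\min\{r\gamma,\,2-\gamma\}}+h^p+\epsilon\big),\qquad 1\le m\le M.$$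
   Context: Problem. Let $0<\gamma<1$, $\alpha\in(0,2)$, $T>0$, $l>0$, $\Omega=(-l,l)$, $\Omega^c=\mathbb R\setminus\Omega$, $\kappa(x,t)>0$. The function $u$ solves $${}^C_0D^\gamma_tu=-\kappa(x,t)(-\Delta)^{\alpha/2}u+f(x,t)\ \ (x\in\Omega,\,t\in(0,T]),\quad u=0\ \ (x\in\Omega^c,\ t\in[0,T]),\quad u(x,0)=\phi(x)\ \ (x\in\Omega),$$ where ${}^C_0D^\gamma_tu(x,t)=\frac1{\Gamma(1-\gamma)}\int_0^t(t-s)^{-\gamma}\partial_su(x,s)\,ds$ and $(-\Delta)^{\alpha/2}u(x)=c_{1,\alpha}\,\mathrm{P.V.}\int_{\mathbb R}\frac{u(x)-u(x')}{|x-x'|^{1+\alpha}}dx'$ with $c_{1,\alpha}=\frac{2^{\alpha-1}\alpha\Gamma(\frac{\alpha+1}{2})}{\sqrt\pi\,\Gamma(1-\alpha/2)}$. It is assumed that $|\partial_t^ku(x,t)|\le c_0t^{\gamma-k}$ for $0\le k\le3$, with a constant $c_0>0$. Mesh. $M,N,r$ are positive integers, $h=2l/N$, $x_i=-l+ih$ ($0\le i\le N$), $t_m=(m/M)^rT$ ($0\le m\le M$), $\tau_m=t_m-t_{m-1}$, $\kappa_i^m=\kappa(x_i,t_m)$, $f_i^m=f(x_i,t_m)$. Temporal discretization. $a^{(m,\gamma)}_k=\frac1{\tau_k}\int_{t_{k-1}}^{t_k}\frac{ds}{(t_m-s)^\gamma}$ for $1\le k\le m$. Let $\epsilon>0$,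 $\delta=(1/M)^rT$, and let $N_{exp}\in\mathbb N^+$, $s_j,w_j>0$ satisfy $\big|t^{-\gamma}-\sum_{j=1}^{N_{exp}}w_je^{-s_jt}\big|\le\epsilon$ for all $t\in[\delta,T]$. Put $b^{(m,\gamma)}_k=\sum_{j=1}^{N_{exp}}w_j\frac1{\tau_k}\int_{t_{k-1}}^{t_k}e^{-s_j(t_m-s)}ds$ for $1\le k\le m-1$, $b^{(m,\gamma)}_m=a^{(m,\gamma)}_m$, and $${}^{FC}D^\gamma_tv^m=\frac1{\Gamma(1-\gamma)}\Big[b^{(m,\gamma)}_mv^m-\sum_{k=1}^{m-1}\big(b^{(m,\gamma)}_{k+1}-b^{(m,\gamma)}_k\big)v^k-b^{(m,\gamma)}_1v^0\Big].$$ Spatial discretization. Let $\mu\in(\alpha,2]$, $\nu=\mu-\alpha$, $\kappa_\mu=1$ if $\mu\in(\alpha,2)$ and $\kappa_\mu=2$ if $\mu=2$, $C^h_{\alpha,\mu}=\frac{c_{1,\alpha}}{\nu h^\alpha}$. For a grid function $v$ with $v_0=v_N=0$ put $(-\Delta)^{\alpha/2}_{h,\mu}v_i=\sum_{j=1}^{N-1}a_{ij}v_j$ ($1\le i\le N-1$), where $$a_{ij}=C^h_{\alpha,\mu}\begin{cases}\sum\limits_{\ell=2}^{N-1}\frac{(\ell+1)^\nu-(\ell-1)^\nu}{\ell^\mu}+\frac{N^\nu-(N-1)^\nu}{N^\mu}+(2^\nu+\kappa_\mu-1)+\frac{2\nu}{\alpha N^\alpha},& j=i,\\[2mm] -\frac{2^\nu+\kappa_\mu-1}{2},&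 j=i\pm1,\\[1mm] -\frac{(|j-i|+1)^\nu-(|j-i|-1)^\nu}{2|j-i|^\mu},& j\neq i,\,i\pm1.\end{cases}$$ FIDS: ${}^{FC}D^\gamma_tu_i^m=-\kappa_i^m(-\Delta)^{\alpha/2}_{h,\mu}u_i^m+f_i^m$ for $1\le i\le N-1$, $1\le m\le M$, with $u_0^m=u_N^m=0$ ($0\le m\le M$) and $u_i^0=\phi(x_i)$ ($1\le i\le N-1$). Local truncation error. Define $R_i^m$ by ${}^{FC}D^\gamma_tU_i^m=-\kappa_i^m(-\Delta)^{\alpha/2}_{h,\mu}U_i^m+f_i^m+R_i^m$. The order $p\in(0,2]$ and the constant $c_2>0$ (depending on the problem but not on $M,N$) are such that $$|R_i^m|\le c_2\big(m^{-\min\{r(1+\gamma),\,2-\gamma\}}+h^p+\epsilon\big),\qquad 1\le i\le N-1,\ 1\le m\le M.$$ Norm: $\|\boldsymbol v\|_\infty=\max_{0\le i\le N}|v_i|$. *)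

(* Defs.v *)
From HB Require Import structures.
From mathcomp Require Import all_boot all_order all_algebra.
From mathcomp Require Import all_classical all_reals all_analysis.

Set Implicit Arguments.
Unset Strict Implicit.
Unset Printing Implicit Defensive.

Import Order.TTheory GRing.Theory Num.Theory.
Import numFieldNormedType.Exports.

Local Open Scope classical_set_scope.
Local Open Scope ring_scope.

(** * Continuous problem *)

Definition Gamma {R : realType} (z : R) : R :=
  \int[@lebesgue_measure R]_(t in `]0, +oo[) (t `^ (z - 1) * expR (- t)).

(* Derivative relative to ]0, T]: the usual one for 0 < t < T, the left
   derivative at t = T, where u is not assumed to make sense beyond T. *)
Definition tquot {R : realType} (g : R -> R) (t : R) : R -> R :=
  fun s => (g s - g t) / (s - t).

Definition tderivable {R : realType} (T : R) (g : R -> R) (t : R) : Prop :=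
  cvg (tquot g t @ within `]0, T] t^').

Definition tderive {R : realType} (T : R) (g : R -> R) : R -> R :=
  fun t => lim (tquot g t @ within `]0, T] t^').

Definition tderiven {R : realType} (T : R) (k : nat) (g : R -> R) : R -> R :=
  iter k (tderive T) g.

(* [is_caputo gamma g t d]: the Caputo derivative of order gamma of g at t
   exists and equals d. *)
Definition is_caputo {R : realType} (gamma : R) (g : R -> R) (t d : R) : Prop :=
  let F := fun s => (t - s) `^ (- gamma) * derive1 g s in
  [/\ forall s, 0 < s < t -> derivable g s 1,
      (@lebesgue_measure R).-integrable `]0, t[ (EFin \o F) &
      d = (Gamma (1 - gamma))^-1 * \int[@lebesgue_measure R]_(s in `]0, t[) F s].

Definition fraclap_const {R : realType} (alpha : R) : R :=
  2 `^ (alpha - 1) * alpha * Gamma ((alpha + 1) / 2)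
  / (Num.sqrt pi * Gamma (1 - alpha / 2)).

(* [is_fraclap alpha v x d]: the principal value defining the fractional
   Laplacian of v at x exists and yields the value d. *)
Definition is_fraclap {R : realType} (alpha : R) (v : R -> R) (x d : R) : Prop :=
  let F := fun y => (v x - v y) / `|x - y| `^ (1 + alpha) in
  let E := fun e : R => [set y : R | e < `|x - y|] in
  (forall e, 0 < e -> (@lebesgue_measure R).-integrable (E e) (EFin \o F)) /\
  fraclap_const alpha * (\int[@lebesgue_measure R]_(y in E e) F y)
    @[e --> 0^'+] --> d.

Definition diffusion_solution {R : realType} (gamma alpha T l : R)
    (kappa f : R -> R -> R) (phi : R -> R) (u : R -> R -> R) : Prop :=
  [/\ forall x t, - l < x < l -> 0 < t <= T ->
        exists D L, [/\ is_caputo gamma (u x) t D,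
                        is_fraclap alpha (fun y => u y t) x L &
                        D = - kappa x t * L + f x t],
      forall x t, ~~ (- l < x < l) -> 0 <= t <= T -> u x t = 0 &
      forall x, - l < x < l -> u x 0 = phi x].

Definition time_regular {R : realType} (gamma T l c0 : R) (u : R -> R -> R)
    : Prop :=
  forall x t, - l < x < l -> 0 < t <= T ->
    (forall k : nat, (k < 3)%N -> tderivable T (tderiven T k (u x)) t) /\
    (forall k : nat, (k <= 3)%N ->
       `|tderiven T k (u x) t| <= c0 * t `^ (gamma - k%:R)).

(** * Mesh *)

Definition xstep {R : realType} (l : R) (N : nat) : R := 2 * l / N%:R.

Definition xnode {R : realType} (l : R) (N i : nat) : R :=
  - l + i%:R * xstep l N.

Definition tnode {R : realType} (T : R) (r M m : nat) : R :=
  (m%:R / M%:R) ^+ r * T.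

(* Used for m >= 1 only. *)
Definition tstep {R : realType} (T : R) (r M m : nat) : R :=
  tnode T r M m - tnode T r M m.-1.

(** * Temporal discretization *)

Definition soe_approx {R : realType} (gamma T : R) (r M : nat) (eps : R)
    (Nexp : nat) (s w : 'I_Nexp -> R) : Prop :=
  [/\ (0 < Nexp)%N,
      forall j, 0 < s j /\ 0 < w j &
      forall t, (1 / M%:R) ^+ r * T <= t <= T ->
        `|t `^ (- gamma) - \sum_(j < Nexp) w j * expR (- s j * t)| <= eps].

Definition acoef {R : realType} (gamma T : R) (r M m k : nat) : R :=
  (tstep T r M k)^-1 *
  \int[@lebesgue_measure R]_(s in `[tnode T r M k.-1, tnode T r M k])
    (tnode T r M m - s) `^ (- gamma).

Definition bcoef {R : realType} (gamma T : R) (r M : nat)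
    (Nexp : nat) (s w : 'I_Nexp -> R) (m k : nat) : R :=
  if k == m then acoef gamma T r M m m
  else \sum_(j < Nexp) w j * ((tstep T r M k)^-1 *
    \int[@lebesgue_measure R]_(y in `[tnode T r M k.-1, tnode T r M k])
      expR (- s j * (tnode T r M m - y))).

Definition fast_caputo {R : realType} (gamma T : R) (r M : nat)
    (Nexp : nat) (s w : 'I_Nexp -> R) (v : nat -> R) (m : nat) : R :=
  let b := bcoef gamma T r M s w m in
  (Gamma (1 - gamma))^-1 *
  (b m * v m - \sum_(1 <= k < m) (b k.+1 - b k) * v k - b 1%N * v 0%N).

(** * Spatial discretization *)

Definition kappa_mu {R : realType} (mu : R) : R := if mu == 2 then 2 else 1.

Definition fdcoef {R : realType} (alpha mu l : R) (N i j : nat) : R :=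
  let nu := mu - alpha in
  let d := `|i - j|%N in
  fraclap_const alpha / (nu * xstep l N `^ alpha) *
  match d with
  | 0 => \sum_(2 <= k < N)
           ((k%:R + 1) `^ nu - (k%:R - 1) `^ nu) / k%:R `^ mu
         + (N%:R `^ nu - (N%:R - 1) `^ nu) / N%:R `^ mu
         + (2 `^ nu + kappa_mu mu - 1)
         + 2 * nu / (alpha * N%:R `^ alpha)
  | 1 => - ((2 `^ nu + kappa_mu mu - 1) / 2)
  | _ => - (((d%:R + 1) `^ nu - (d%:R - 1) `^ nu) / (2 * d%:R `^ mu))
  end.

Definition discrete_fraclap {R : realType} (alpha mu l : R) (N : nat)
    (v : nat -> R) (i : nat) : R :=
  \sum_(1 <= j < N) fdcoef alpha mu l N i j * v j.

(** * Scheme and truncation error *)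

(* A grid function v has value v i m at the node (x_i, t_m); its values for
   i > N or m > M are never used. *)
Definition fids_solution {R : realType} (gamma alpha mu T l : R) (r M N : nat)
    (Nexp : nat) (s w : 'I_Nexp -> R)
    (kappa f : R -> R -> R) (phi : R -> R) (v : nat -> nat -> R) : Prop :=
  [/\ forall i m, (1 <= i < N)%N -> (1 <= m <= M)%N ->
        fast_caputo gamma T r M s w (v i) m =
          - kappa (xnode l N i) (tnode T r M m)
            * discrete_fraclap alpha mu l N (fun j => v j m) i
          + f (xnode l N i) (tnode T r M m),
      forall m, (m <= M)%N -> v 0%N m = 0 /\ v N m = 0 &
      forall i, (1 <= i < N)%N -> v i 0%N = phi (xnode l N i)].

Definition grid_restr {R : realType} (T l : R) (r M N : nat)
    (u : R -> R -> R) : nat -> nat -> R :=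
  fun i m => u (xnode l N i) (tnode T r M m).

Definition trunc_error {R : realType} (gamma alpha mu T l : R) (r M N : nat)
    (Nexp : nat) (s w : 'I_Nexp -> R)
    (kappa f u : R -> R -> R) (i m : nat) : R :=
  let U := grid_restr T l r M N u in
  fast_caputo gamma T r M s w (U i) m
  - (- kappa (xnode l N i) (tnode T r M m)
       * discrete_fraclap alpha mu l N (fun j => U j m) i
     + f (xnode l N i) (tnode T r M m)).

Definition max_norm {R : realType} (N : nat) (v : nat -> R) : R :=
  \big[Num.max/0]_(i < N.+1) `|v i|.

(* Main.v *)
Require Import Defs.
From HB Require Import structures.
From mathcomp Require Import all_boot all_order all_algebra.
From mathcomp Require Import all_classical all_reals all_analysis.
From mathcomp Require Import measurable_realfun.
From mathcomp Require Import ring lra zify.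

Set Implicit Arguments.
Unset Strict Implicit.
Unset Printing Implicit Defensive.

Import Order.TTheory GRing.Theory Num.Theory.
Import numFieldNormedType.Exports.

Local Open Scope classical_set_scope.
Local Open Scope ring_scope.

(** The error e = U - v solves the scheme itself, with zero initial and boundary
    data and with the truncation error R as source. So the theorem is a
    stability estimate for the scheme, followed by a comparison of the bound on
    R with the size of the first history weight.

    Write b_k for the weights at level m. At an interior node i where |e^m| is
    maximal, e_i^m times the discrete fractional Laplacian of e^m is
    nonnegative, since its matrix has nonpositive off-diagonal entries and nonnegative row
    sums (discrete_max_principle). If moreover b_1 <= ... <= b_m, multiplying
    the scheme at node i by e_i^m and dropping the diffusion term leaves
      b_m |e_i^m| <= sum_(1 <= k < m) (b_(k+1) - b_k) |e_i^k|
                     + Gamma(1 - gamma) |R_i^m|.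
    If K satisfies Gamma(1 - gamma) |R_i^j| <= K b_1^(j) at all levels j, then
    by induction the right side is at most (b_m - b_1) K + b_1 K = b_m K. This
    is fids_stability.

    Monotonicity (bcoef_nondecreasing): for k < m, b_k is the average over the
    k-th step of s |-> S(t_m - s), where S is the exponential sum. This
    function increases with s, so these averages increase with k. The last one
    is at most S(tau_m) <= tau_m^(-gamma) + eps, whereas the exact weight is
    b_m = tau_m^(-gamma) / (1 - gamma). The gap between tau_m^(-gamma) and b_m
    is gamma / (1 - gamma) tau_m^(-gamma), and as tau_m <= r T / M it is at
    least eps when eps <= c1 M^gamma with
    c1 = gamma / (1 - gamma) (r T)^(-gamma).

    Size of b_1 (bcoef1_ge): the same averages give
    b_1 >= S(t_m) >= t_m^(-gamma) - eps, which is at least half of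
    t_m^(-gamma) when eps <= T^(-gamma) / 2. Hence K may be any bound of
    2 Gamma(1 - gamma) c2 t_j^gamma (j^(-q) + h^p + eps) over j, where
    q = min (r (1 + gamma)) (2 - gamma), and truncation_weight_le bounds
    j^(-q) t_j^gamma by T^gamma M^(-min (r gamma) (2 - gamma)).

    Two singular integrals have to be evaluated or bounded on the way: the one
    in b_m, and Gamma(1 - gamma), whose finiteness and positivity allow the
    scheme to be multiplied by it. Both come from ge0_FTC2_oo. *)

(** * Integrals with a singular endpoint *)

(** The integrand may blow up at the endpoints, as a negative power does: the
    formula on compact subintervals passes to the limit by monotone
    convergence, and F is continuous at the endpoints. *)
Lemma ge0_FTC2_oo (R : realType) (f F : R -> R) (a b : R) : a < b ->
  {in `]a, b[, continuous f} ->
  (forall x, a < x < b -> 0 <= f x) ->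
  derivable_oo_LRcontinuous F a b ->
  {in `]a, b[, derive1 F =1 f} ->
  (\int[@lebesgue_measure R]_(x in `]a, b[) (f x)%:E = (F b - F a)%:E)%E.
Proof.
move=> ab cf f0 [dF Fa Fb] F'f.
pose d n : R := (b - a) / n.+3%:R.
have ba0 : 0 < b - a by rewrite subr_gt0.
have d0 n : 0 < d n by rewrite divr_gt0.
have d_anti m n : (m <= n)%N -> d n <= d m.
  by move=> mn; rewrite ler_pM2l// lef_pV2 ?posrE// ler_nat.
have dlt n : a + d n < b - d n.
  have : d n <= (b - a) / 3 by rewrite ler_pM2l// lef_pV2 ?posrE// ler_nat.
  by move: ba0; lra.
have dcvg : d n @[n --> \oo] --> 0.
  rewrite -(mulr0 (b - a)); apply: cvgMl_tmp.
  rewrite (_ : (fun n => n.+3%:R^-1) = (fun n => harmonic (n + 2)%N)).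
    by rewrite cvg_shiftn; exact: cvg_harmonic.
  by apply/funext => n; rewrite /harmonic addn2.
(* With the offset 3 in d, even D 0 is nondegenerate. *)
pose D n := `[a + d n, b - d n]%classic.
have DE n x : D n x -> a < x < b.
  rewrite /D/= in_itv/= => /andP[h1 h2]; have := d0 n.
  by move: h1 h2 => h1 h2 h3; apply/andP; split; move: h1 h2 h3; lra.
have DU : `]a, b[%classic = \bigcup_n D n.
  apply/seteqP; split => [x/=|x [n _ /DE]]; last by rewrite /= in_itv.
  rewrite in_itv/= => /andP[ax xb].
  have e0 : 0 < Num.min (x - a) (b - x) by rewrite lt_min !subr_gt0 ax xb.
  have /cvgrPdist_lt/(_ _ e0)[n _ /(_ n (leqnn n))] := dcvg.
  rewrite /= sub0r normrN gtr0_norm// lt_min => /andP[h1 h2].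
  by exists n => //; rewrite /D/= in_itv/=; move: h1 h2; lra.
have mf : measurable_fun `]a, b[ f.
  by apply: open_continuous_measurable_fun => // x; rewrite inE => /cf.
have intD n : (\int[@lebesgue_measure R]_(x in D n) (f x)%:E =
    (F (b - d n) - F (a + d n))%:E)%E.
  rewrite EFinB; apply: continuous_FTC2 => //.
  - apply: continuous_in_subspaceT => x; rewrite inE => /DE xab.
    by apply: cf; rewrite in_itv.
  - have dFab x : D n x -> derivable F x 1.
      by move=> /DE xab; apply: dF; rewrite in_itv.
    have /(continuous_within_itvP _ (dlt n))[_ ? ?] :
        {within D n, continuous F}.
      by apply: derivable_within_continuous => x; exact: dFab.
    split => // x xD; apply: dFab; exact: subset_itv_oo_cc.
  - move=> x xD; apply: F'f; rewrite in_itv/=; apply: (@DE n).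
    exact: subset_itv_oo_cc.
have lim1 : (\int[@lebesgue_measure R]_(x in D n) (f x)%:E)%E @[n --> \oo]
    --> (\int[@lebesgue_measure R]_(x in `]a, b[) (f x)%:E)%E.
  rewrite DU; apply: ge0_nondecreasing_set_cvg_integral.
  - apply/nondecreasing_seqP => n; rewrite subsetEset => x.
    rewrite /D/= !in_itv/= => /andP[h1 h2]; have := d_anti n n.+1 (leqnSn _).
    by move: h1 h2; lra.
  - by move=> n; exact: measurable_itv.
  - move=> n; apply/measurable_EFinP; apply: measurable_funS mf => //.
    by move=> x /DE; rewrite /= in_itv.
  - by move=> n x /DE xab; rewrite lee_fin f0.
have lim2 : (F (b - d n) - F (a + d n)) @[n --> \oo] --> F b - F a.
  apply: cvgB.
  - apply: (cvg_at_leftP F b (F b)).1 => //; split => [n|].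
      by rewrite ltrBlDr ltrDl.
    by rewrite -[X in _ --> X]subr0; apply: cvgB => //; exact: cvg_cst.
  - apply: (cvg_at_rightP F a (F a)).1 => //; split => [n|].
      by rewrite ltrDl.
    by rewrite -[X in _ --> X]addr0; apply: cvgD => //; exact: cvg_cst.
apply: (cvg_unique _ lim1) => //.
rewrite (_ : (fun n => _) = EFin \o (fun n => F (b - d n) - F (a + d n))).
  by apply: cvg_EFin => //; exact: nearW.
by apply/funext.
Qed.

Lemma powR_continuous (R : realType) (p x : R) : 0 < x ->
  {for x, continuous (fun t : R => t `^ p)}.
Proof.
move=> x0; apply/differentiable_continuous/derivable1_diffP.
by apply: derivable_powR; rewrite in_itv/= x0.
Qed.

Lemma integral_powRN (R : realType) (g c : R) : g < 1 -> 0 < c ->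
  (\int[@lebesgue_measure R]_(s in `]0%R, c[) (s `^ (- g))%:E =
   (c `^ (1 - g) / (1 - g))%:E)%E.
Proof.
move=> g1 c0.
have g1' : 0 < 1 - g by rewrite subr_gt0.
pose F := (1 - g)^-1 \*: (fun t : R => t `^ (1 - g)) : R -> R.
have dF (s : R) : 0 < s -> is_derive s 1 F (s `^ (- g)).
  move=> s0; have /is_derive_eq : is_derive s 1 F _ :=
    is_deriveZ _ (is_derive1_powR (1 - g) s0).
  apply; rewrite /GRing.scale/= mulKf ?gt_eqF//; congr (_ `^ _); ring.
have F0 : F 0 = 0 by rewrite /F/= powR0 ?scaler0 ?gt_eqF.
rewrite (@ge0_FTC2_oo _ _ F) //.
- by rewrite F0 subr0 /F/= mulrC.
- by move=> s; rewrite in_itv/= => /andP[s0 _]; exact: powR_continuous.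
- by move=> x _; exact: powR_ge0.
- split.
  + by move=> s; rewrite in_itv/= => /andP[s0 _]; have [] := dF s s0.
  + rewrite F0 -[X in _ --> X](scaler0 _ (1 - g)^-1).
    by apply: cvgZl_tmp; exact: powR_cvg0.
  + apply: cvg_at_left_filter; apply: cvgZl_tmp; exact: powR_continuous.
- move=> s; rewrite in_itv/= => /andP[s0 _].
  by rewrite derive1E; have [] := dF s s0.
Qed.

Lemma integral_powRN_left (R : realType) (g a b : R) : g < 1 -> a < b ->
  (\int[@lebesgue_measure R]_(s in `]a, b[) ((b - s) `^ (- g))%:E =
   ((b - a) `^ (1 - g) / (1 - g))%:E)%E.
Proof.
move=> g1 ab.
have g1' : 0 < 1 - g by rewrite subr_gt0.
pose F := (- (1 - g)^-1) \*:
  ((fun t : R => t `^ (1 - g)) \o (cst b \- id)) : R -> R.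
have cB (s : R) : (b - t) @[t --> s] --> b - s.
  by apply: cvgB; [exact: cvg_cst|exact: cvg_id].
have dF (s : R) : s < b -> is_derive s 1 F ((b - s) `^ (- g)).
  move=> sb; have bs : 0 < b - s by rewrite subr_gt0.
  have dB : is_derive s 1 (cst b \- id) (0 - 1 : R) by exact: is_deriveB.
  have /is_derive_eq : is_derive s 1 F _ :=
    is_deriveZ _ (@is_derive1_comp _ (fun t : R => t `^ (1 - g))
      (cst b \- id) _ _ _ (is_derive1_powR (1 - g) bs) dB).
  apply; rewrite /GRing.scale/= sub0r mulrN1 mulrNN mulKf ?gt_eqF//.
  by congr (_ `^ _); ring.
have Fb : F b = 0 by rewrite /F/= subrr powR0 ?scaler0 ?gt_eqF.
have cpow p s : s < b -> {for s, continuous (fun t : R => (b - t) `^ p)}.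
  move=> sb.
  apply: (@continuous_comp _ _ _ (fun t : R => b - t) (fun t : R => t `^ p)).
    exact: cB.
  by apply: powR_continuous; rewrite subr_gt0.
rewrite (@ge0_FTC2_oo _ _ F) //.
- by rewrite Fb sub0r /F/= scaleNr opprK mulrC.
- by move=> s; rewrite in_itv/= => /andP[_ sb]; exact: cpow.
- by move=> x _; exact: powR_ge0.
- split.
  + by move=> s; rewrite in_itv/= => /andP[_ sb]; have [] := dF s sb.
  + apply: cvg_at_right_filter; apply: cvgZl_tmp; exact: cpow.
  + rewrite Fb -[X in _ --> X](scaler0 _ (- (1 - g)^-1)).
    apply: cvgZl_tmp; apply/cvg_at_leftP => u [ub ucvg].
    have /cvg_at_rightP := powR_cvg0 g1'; apply; split.
      by move=> n; rewrite subr_gt0.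
    by rewrite -(subrr b); apply: cvgB => //; exact: cvg_cst.
- move=> s; rewrite in_itv/= => /andP[_ sb].
  by rewrite derive1E; have [] := dF s sb.
Qed.

(** A divergent integral would give Gamma z = 0, so the point is finiteness:
    the integrand is at most t^(z - 1) on ]0, 1[ and at most e^(-t) on
    [1, +oo[. *)
Lemma Gamma_gt0 (R : realType) (z : R) : 0 < z < 1 -> 0 < Gamma z.
Proof.
move=> /andP[z0 z1].
pose mu := @lebesgue_measure R.
pose h (t : R) := t `^ (z - 1) * expR (- t).
have h0 t : 0 <= h t by rewrite mulr_ge0 ?powR_ge0 ?expR_ge0.
have mN : measurable_fun [set: R] (fun t : R => expR (- t)).
  apply: continuous_measurable_fun => t.
  by apply: continuous_comp; [exact: continuousN|exact: continuous_expR].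
have mp : measurable_fun [set: R] (fun t : R => t `^ (z - 1)).
  exact: measurable_powR.
have mh : measurable_fun [set: R] (EFin \o h).
  by apply/measurable_EFinP; exact: measurable_funM.
have near0 : (\int[mu]_(t in `]0%R, 1%R[) (h t)%:E < +oo)%E.
  apply: (@le_lt_trans _ _
    (\int[mu]_(t in `]0%R, 1%R[) (t `^ (- (1 - z)))%:E)%E).
    apply: ge0_le_integral => //=.
    - by move=> t _; rewrite lee_fin.
    - exact: measurable_funS mh.
    - apply/measurable_EFinP; rewrite opprB; exact: measurable_funS mp.
    - move=> t; rewrite in_itv/= => /andP[t0 _]; rewrite lee_fin opprB.
      by rewrite ler_piMr ?powR_ge0// -expR0 ler_expR oppr_le0 ltW.
  by rewrite integral_powRN ?ltry//; move: z0; lra.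
have nearoo : (\int[mu]_(t in `[1%R, +oo[) (h t)%:E < +oo)%E.
  apply: (@le_lt_trans _ _
    (\int[mu]_(t in `[1%R, +oo[) (expR (- t))%:E)%E).
    apply: ge0_le_integral => //=.
    - by move=> t _; rewrite lee_fin.
    - exact: measurable_funS mh.
    - apply/measurable_EFinP; exact: measurable_funS mN.
    - move=> t; rewrite in_itv/= => /andP[t0 _]; rewrite lee_fin.
      rewrite ler_piMl ?expR_ge0// -[leRHS](powRr0 t) ler_powR//.
      by rewrite subr_le0 ltW.
  have dE (t : R) : is_derive t 1 (fun t => - expR (- t)) (expR (- t)).
    by apply: is_derive_eq; rewrite mulrN1 opprK.
  rewrite (@ge0_continuous_FTC2y _ _ (fun t => - expR (- t)) _ 0) ?ltry//.
  - apply: continuous_subspaceT => t.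
    by apply: continuous_comp; [exact: continuousN|exact: continuous_expR].
  - by rewrite -oppr0; apply: cvgN; exact: cvgr_expR.
  - apply: cvg_at_right_filter; apply: cvgN.
    by apply: continuous_comp; [exact: continuousN|exact: continuous_expR].
  - by move=> t _; rewrite derive1E; have [] := dE t.
have fin : (\int[mu]_(t in `]0%R, +oo[) (h t)%:E < +oo)%E.
  have -> : `]0%R, +oo[%classic =
      `]0%R, 1%R[%classic `|` `[1%R, +oo[%classic :> set R.
    apply/seteqP; split => t /=; rewrite !in_itv/= ?andbT.
      by case: (ltP t 1) => [t1 ->|t1 _]; [left|right].
    by move=> [/andP[]|] //; exact: lt_le_trans.
  rewrite ge0_integral_setU//=.
  - exact: lte_add_pinfty.
  - exact: measurable_funS mh.
  - by move=> t _; rewrite lee_fin.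
  - apply/disj_setPS => t [/=]; rewrite !in_itv/= => /andP[_ t1].
    by rewrite leNgt t1.
have pos : (0 < \int[mu]_(t in `]0%R, +oo[) (h t)%:E)%E.
  pose c : R := 2 `^ (z - 1) * expR (- 2).
  have c0 : 0 < c by rewrite mulr_gt0 ?powR_gt0 ?expR_gt0.
  apply: (@lt_le_trans _ _ (\int[mu]_(t in `[1%R, 2%R]) c%:E)%E).
    rewrite integral_cst//= lebesgue_measure_itv/= lte_fin ifT ?ltr1n//.
    by rewrite -EFinD -EFinM lte_fin mulr_gt0// subr_gt0 ltr1n.
  apply: (@le_trans _ _ (\int[mu]_(t in `[1%R, 2%R]) (h t)%:E)%E).
    apply: ge0_le_integral => //=.
    - by move=> t _; rewrite lee_fin ltW.
    - exact: measurable_funS mh.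
    - move=> t; rewrite in_itv/= => /andP[t1 t2]; rewrite lee_fin.
      rewrite ler_pM ?powR_ge0 ?expR_ge0//; last by rewrite ler_expR lerN2.
      rewrite -(opprB 1 z) !powRN.
      rewrite lef_pV2 ?posrE ?powR_gt0 ?(lt_le_trans _ t1)//.
      by apply: ge0_ler_powR; rewrite ?nnegrE//; lra.
  apply: ge0_subset_integral => //=.
  - exact: measurable_funS mh.
  - by move=> t _; rewrite lee_fin.
  - by move=> t /=; rewrite !in_itv/= andbT => /andP[/(lt_le_trans ltr01)].
by rewrite /Gamma /Rintegral fine_gt0// pos fin.
Qed.

(** * Averages over a time step *)

Lemma average_powRN_left (R : realType) (g a b : R) : g < 1 -> a < b ->
  (b - a)^-1 * \int[@lebesgue_measure R]_(s in `[a, b]) ((b - s) `^ (- g))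
  = (b - a) `^ (- g) / (1 - g).
Proof.
move=> g1 ab; have ba : 0 < b - a by rewrite subr_gt0.
rewrite /Rintegral integral_itv_bndoo ?integral_powRN_left//=; last first.
  apply/measurable_EFinP/measurable_funTS.
  have -> : (fun s : R => (b - s) `^ (- g)) =
    (fun t : R => t `^ (- g)) \o (fun s : R => b - s) by [].
  by apply: measurableT_comp; [exact: measurable_powR|exact: measurable_funB].
have ba' : b - a != 0 by rewrite gt_eqF.
by rewrite powRD ?ba' ?implybT// powRr1 ?ltW// !mulrA mulVf// mul1r.
Qed.

Lemma average_nondecreasing (R : realType) (f : R -> R) (a b : R) : a < b ->
  continuous f -> {homo f : x y / x <= y} ->
  f a <= (b - a)^-1 * \int[@lebesgue_measure R]_(y in `[a, b]) f y <= f b.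
Proof.
move=> ab cf ndf; have ba : 0 < b - a by rewrite subr_gt0.
have intf (h : R -> R) : continuous h ->
    (@lebesgue_measure R).-integrable `[a, b] (EFin \o h).
  move=> ch; apply: continuous_compact_integrable; first exact: segment_compact.
  exact: continuous_subspaceT.
have cstE c : c = (b - a)^-1 * \int[@lebesgue_measure R]_(y in `[a, b]) c.
  rewrite Rintegral_cst//= lebesgue_measure_itv/= lte_fin ab -EFinB/=.
  by rewrite mulrCA mulVf ?mulr1// gt_eqF.
rewrite [X in X <= _]cstE [X in _ && (_ <= X)]cstE !ler_pM2l ?invr_gt0//.
apply/andP; split; apply: le_Rintegral => //.
- by apply: intf => x; exact: cvg_cst.
- exact: intf.
- by move=> x /=; rewrite in_itv/= => /andP[/ndf].
- exact: intf.
- by apply: intf => x; exact: cvg_cst.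
- by move=> x /=; rewrite in_itv/= => /andP[_ /ndf].
Qed.

(** * The graded mesh *)

Section mesh.
Context {R : realType} (T : R) (r M : nat).
Context (T0 : 0 < T) (r0 : (0 < r)%N) (M0 : (0 < M)%N).

Let M0' : 0 < M%:R :> R. Proof. by rewrite ltr0n. Qed.

Lemma tnodeE m : tnode T r M m = m%:R ^+ r / M%:R ^+ r * T.
Proof. by rewrite /tnode expr_div_n. Qed.

Lemma tnode0 : tnode T r M 0 = 0.
Proof. by rewrite /tnode mul0r expr0n eqn0Ngt r0 mul0r. Qed.

Lemma tnodeM : tnode T r M M = T.
Proof. by rewrite /tnode divff ?gt_eqF// expr1n mul1r. Qed.

Lemma tnode_lt m n : (m < n)%N -> tnode T r M m < tnode T r M n.
Proof.
move=> mn; rewrite /tnode ltr_pM2r// ltrXn2r -?lt0n// ?divr_ge0//.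
by rewrite ltr_pM2r ?invr_gt0// ltr_nat.
Qed.

Lemma tnode_le m n : (m <= n)%N -> tnode T r M m <= tnode T r M n.
Proof. by rewrite leq_eqVlt => /predU1P[->//|/tnode_lt/ltW]. Qed.

Lemma tnode_gt0 m : (0 < m)%N -> 0 < tnode T r M m.
Proof. by rewrite -tnode0; exact: tnode_lt. Qed.

Lemma tnode_itv m : (0 < m <= M)%N -> tnode T r M 1 <= tnode T r M m <= T.
Proof.
by move=> /andP[m0 mM]; rewrite tnode_le//= -[leRHS]tnodeM tnode_le.
Qed.

Lemma tstep_gt0 m : (0 < m)%N -> 0 < tstep T r M m.
Proof. by move=> m0; rewrite subr_gt0 tnode_lt// ltn_predL. Qed.

(** The steps are at least the first one, tau_1 = t_1, which is the lower end
    of the interval where the exponential sum is accurate. *)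
Lemma tnode1_le_tstep m : (0 < m)%N -> tnode T r M 1 <= tstep T r M m.
Proof.
case: m => // m _; rewrite /tstep !tnodeE -mulrBl -mulrBl.
rewrite !ler_pM2r ?invr_gt0 ?exprn_gt0//.
rewrite expr1n -natrX -natrX -natrB ?leq_exp2r// ler1n subn_gt0.
by rewrite ltn_exp2r.
Qed.

(** Mean value bound for x |-> x^r on [0, 1], through the factorization of
    x^r - y^r. *)
Lemma tstep_le m : (0 < m <= M)%N -> tstep T r M m <= r%:R * T / M%:R.
Proof.
move=> /andP[]; case: m => // m _ mM.
rewrite /tstep /tnode -mulrBl subrXX -mulrBl /=.
have -> : m.+1%:R - m%:R = 1 :> R by rewrite -natr1; ring.
have sumr : \sum_(i < r) (m.+1%:R / M%:R) ^+ (r.-1 - i) * (m%:R / M%:R) ^+ i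
    <= r%:R :> R.
  apply: (@le_trans _ _ (\sum_(i < r) 1)); last by rewrite sumr_const card_ord.
  apply: ler_sum => i _; rewrite mulr_ile1 ?exprn_ge0 ?divr_ge0//.
    by rewrite exprn_ile1 ?divr_ge0// ler_pdivrMr// mul1r ler_nat.
  by rewrite exprn_ile1 ?divr_ge0// ler_pdivrMr// mul1r ler_nat ltnW.
have -> : r%:R * T / M%:R = M%:R^-1 * r%:R * T by ring.
by rewrite mul1r ler_pM2r// ler_pM2l ?invr_gt0.
Qed.

End mesh.

(** * Weights of the fast Caputo derivative *)

Definition exp_sum {R : realType} (Nexp : nat) (s w : 'I_Nexp -> R) (t : R)
    : R :=
  \sum_(j < Nexp) w j * expR (- s j * t).

Section time_coef.
Context {R : realType} (gamma T : R) (r M Nexp : nat) (eps : R).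
Context (s w : 'I_Nexp -> R).
Context (hg : 0 < gamma < 1) (T0 : 0 < T) (r0 : (0 < r)%N) (M0 : (0 < M)%N).
Context (hsoe : soe_approx gamma T r M eps s w).

Let b := bcoef gamma T r M s w.

Lemma acoef_diag m : (0 < m)%N ->
  acoef gamma T r M m m = tstep T r M m `^ (- gamma) / (1 - gamma).
Proof.
move=> m0; rewrite /acoef average_powRN_left//; first by case/andP: hg.
by rewrite tnode_lt// ltn_predL.
Qed.

(** The kernel s |-> exp_sum (t_m - s) increases on the step, so its average
    lies between its values at the two ends. *)
Lemma bcoef_exp_sum m k : (0 < k < m)%N ->
  exp_sum s w (tnode T r M m - tnode T r M k.-1) <= b m k
    <= exp_sum s w (tnode T r M m - tnode T r M k).
Proof.
move=> /andP[k0 km]; rewrite /b /bcoef ltn_eqF// /exp_sum.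
have avg j := @average_nondecreasing R
  (fun y => expR (- s j * (tnode T r M m - y)))
  (tnode T r M k.-1) (tnode T r M k).
have {}avg j : expR (- s j * (tnode T r M m - tnode T r M k.-1)) <=
    (tstep T r M k)^-1 *
      \int[@lebesgue_measure R]_(y in `[tnode T r M k.-1, tnode T r M k])
        expR (- s j * (tnode T r M m - y))
    <= expR (- s j * (tnode T r M m - tnode T r M k)).
  apply: avg.
  - by rewrite tnode_lt// ltn_predL.
  - move=> y; apply: continuous_comp; last exact: continuous_expR.
    by apply: cvgMr; apply: cvgB; [exact: cvg_cst|exact: cvg_id].
  - move=> x y xy; rewrite ler_expR !mulNr lerN2 ler_pM2l ?lerB//.
    by have [_ /(_ j)[]] := hsoe.
have w0 j : 0 <= w j by have [_ /(_ j)[_ /ltW]] := hsoe.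
by apply/andP; split; apply: ler_sum => j _; rewrite ler_wpM2l//;
  have /andP[] := avg j.
Qed.

Lemma exp_sum_err t : tnode T r M 1 <= t <= T ->
  t `^ (- gamma) - eps <= exp_sum s w t <= t `^ (- gamma) + eps.
Proof.
have [_ _ h] := hsoe => /h; rewrite ler_norml /exp_sum => /andP[h1 h2].
by apply/andP; split; move: h1 h2; lra.
Qed.

(** Below k = m - 1 both weights are compared with the kernel at the common
    end t_k of their steps. For k = m - 1 the right member is the exact weight
    tau_m^(-gamma) / (1 - gamma), and the bound on eps is what lets it absorb
    the error of the exponential sum at tau_m. *)
Lemma bcoef_nondecreasing m k :
  eps <= gamma / (1 - gamma) * (r%:R * T) `^ (- gamma) * M%:R `^ gamma ->
  (0 < k < m)%N -> (m <= M)%N -> b m k <= b m k.+1.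
Proof.
move=> heps /andP[k0 km] mM; have /andP[g0 g1] := hg.
have /andP[_ bk] := @bcoef_exp_sum m k (introT andP (conj k0 km)).
apply: (le_trans bk).
have [k1m|] := ltnP k.+1 m.
  by have /andP[] := @bcoef_exp_sum m k.+1 k1m.
move=> mk; have {mk km}mE : m = k.+1 by apply/eqP; rewrite eqn_leq mk.
have m0 : (0 < m)%N by rewrite mE.
rewrite -mE [b m m]/bcoef eqxx acoef_diag//.
have -> : tnode T r M m - tnode T r M k = tstep T r M m by rewrite /tstep mE.
have t0 := tstep_gt0 T0 r0 M0 m0.
have tT : tstep T r M m <= T.
  rewrite /tstep lerBlDr (@le_trans _ _ T) ?lerDl//.
    by have /andP[] := @tnode_itv R T r M T0 r0 M0 m
      (introT andP (conj m0 mM)).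
  by rewrite -(@tnode0 R T r M r0); exact: tnode_le.
have /exp_sum_err/andP[_ /le_trans] : tnode T r M 1 <= tstep T r M m <= T.
  by rewrite tT andbT; exact: tnode1_le_tstep.
apply; set y := tstep T r M m `^ _.
(* eps fits in the gap y / (1 - gamma) - y. *)
have heps' : eps <= gamma / (1 - gamma) * y.
  apply: (le_trans heps); rewrite -mulrA ler_wpM2l//.
    by rewrite divr_ge0 ?subr_ge0 ?ltW.
  have <- : (r%:R * T / M%:R) `^ (- gamma) =
      (r%:R * T) `^ (- gamma) * M%:R `^ gamma.
    rewrite powRM ?invr_ge0 ?mulr_ge0 ?(ltW T0)//.
    congr (_ * _).
    by rewrite -powR_inv1// -powRrM mulrN mulN1r opprK.
  have q0 : 0 < r%:R * T / M%:R by rewrite divr_gt0 ?mulr_gt0 ?ltr0n.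
  rewrite /y !powRN lef_pV2 ?posrE ?powR_gt0//.
  rewrite ge0_ler_powR ?nnegrE ?(ltW g0) ?(ltW q0) ?(ltW t0)//.
  by apply: tstep_le => //; rewrite m0.
have -> : y / (1 - gamma) = y + gamma / (1 - gamma) * y.
  by field; rewrite subr_eq0 gt_eqF.
by rewrite lerD2l.
Qed.

Lemma bcoef1_ge m : eps <= 2^-1 * T `^ (- gamma) -> (0 < m <= M)%N ->
  2^-1 * tnode T r M m `^ (- gamma) <= b m 1%N.
Proof.
move=> heps /andP[m0 mM]; have /andP[g0 g1] := hg.
have /andP[t1 tT] : tnode T r M 1 <= tnode T r M m <= T.
  by apply: tnode_itv => //; rewrite m0.
have t0 := tnode_gt0 T0 r0 M0 m0.
have heps' : eps <= 2^-1 * tnode T r M m `^ (- gamma).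
  apply: (le_trans heps); rewrite ler_pM2l ?invr_gt0//.
  rewrite !powRN lef_pV2 ?posrE ?powR_gt0//.
  by rewrite ge0_ler_powR ?nnegrE ?(ltW g0) ?(ltW T0) ?(ltW t0).
have [m1|] := ltnP 1 m.
  have /andP[+ _] := @bcoef_exp_sum m 1 m1; apply: le_trans.
  rewrite /= tnode0// subr0.
  have /exp_sum_err/andP[+ _] : tnode T r M 1 <= tnode T r M m <= T.
    by rewrite t1.
  by apply: le_trans; move: heps'; lra.
(* At the first level the only weight is the exact one. *)
move=> m1; have -> : m = 1%N by apply/eqP; rewrite eqn_leq m1.
rewrite /b /bcoef eqxx acoef_diag// /tstep /= tnode0// subr0 mulrC.
rewrite ler_wpM2l ?powR_ge0// lef_pV2 ?posrE ?subr_gt0//; last first.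
  by move: g0; lra.
Qed.

End time_coef.

(** * Maximum principle for the discrete fractional Laplacian *)

Lemma sum_dist_split (V : zmodType) (F : nat -> V) (N i : nat) :
  (0 < i < N)%N ->
  \sum_(1 <= j < N) F `|i - j|%N =
  \sum_(1 <= d < i) F d + F 0%N + \sum_(1 <= d < N - i) F d.
Proof.
move=> /andP[i0 iN].
rewrite (@big_cat_nat _ _ _ i)//=; last exact: ltnW.
rewrite (@big_ltn _ _ _ i N)//= distnn -addrA; congr (_ + (_ + _)).
  rewrite big_nat_rev/=; apply: eq_big_nat => j /andP[j1 ji].
  by rewrite distnEl; [congr F; lia|lia].
rewrite -{1}(add1n i) big_addn; apply: eq_big_nat => j /andP[j1 ji].
by rewrite distnEr; [congr F; lia|lia].
Qed.

Section space.
Context {R : realType} (alpha mu l : R) (N : nat).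
Context (ha : 0 < alpha < 2) (hmu : alpha < mu).

Let nu := mu - alpha.

Let nu0 : 0 < nu. Proof. by rewrite subr_gt0. Qed.

Lemma Gamma_ge0 (z : R) : 0 <= Gamma z.
Proof.
by apply: Rintegral_ge0 => t _; rewrite mulr_ge0 ?powR_ge0 ?expR_ge0.
Qed.

Lemma fraclap_const_ge0 : 0 <= fraclap_const alpha.
Proof.
have /andP[/ltW a0 _] := ha.
by rewrite divr_ge0 ?mulr_ge0 ?Gamma_ge0 ?powR_ge0 ?sqrtr_ge0.
Qed.

Let C := fraclap_const alpha / (nu * xstep l N `^ alpha).

Let C0 : 0 <= C.
Proof. by rewrite divr_ge0 ?fraclap_const_ge0 ?mulr_ge0 ?powR_ge0// ltW. Qed.

Let kappa_mu_ge1 : 1 <= kappa_mu mu.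
Proof. by rewrite /kappa_mu; case: ifP => _; rewrite ?ler1n. Qed.

Let q (d : nat) : R :=
  ((d%:R + 1) `^ nu - (d%:R - 1) `^ nu) / d%:R `^ mu.

Let q0 d : (0 < d)%N -> 0 <= q d.
Proof.
move=> d0; rewrite divr_ge0 ?powR_ge0// subr_ge0.
have d1 : 0 <= d%:R - 1 :> R by rewrite subr_ge0 ler1n.
rewrite ge0_ler_powR ?nnegrE ?(ltW nu0)//.
by rewrite lerD2l; lra.
Qed.

(** Half of C p(d) is the strength of the coupling between nodes at distance d;
    C times the sum of p over 1 <= d < N is the diagonal entry up to a
    nonnegative remainder. *)
Let p (d : nat) : R := if d == 1%N then 2 `^ nu + kappa_mu mu - 1 else q d.

Let p0 d : (0 < d)%N -> 0 <= p d.
Proof.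
move=> d0; rewrite /p; case: eqP => _; last exact: q0.
by rewrite -addrA addr_ge0 ?powR_ge0// subr_ge0.
Qed.

Lemma fdcoef_offdiag i j : i != j ->
  fdcoef alpha mu l N i j = - (C * (p `|i - j|%N / 2)).
Proof.
rewrite /fdcoef -distn_eq0 -/nu -/C /p; case: `|i - j|%N => [//|[|d]] _ /=.
  by rewrite mulrN.
by rewrite mulrN /q invfM; congr (- (C * _)); rewrite mulrA mulrAC.
Qed.

Lemma fdcoef_offdiag_le0 i j : i != j -> fdcoef alpha mu l N i j <= 0.
Proof.
move=> ij; rewrite fdcoef_offdiag// oppr_le0 mulr_ge0// divr_ge0// p0//.
by rewrite lt0n distn_eq0.
Qed.

(** The nodes on each side of i take away at most half of the sum of p, and the
    diagonal contains the whole sum. *)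
Lemma fdcoef_row_sum_ge0 i : (0 < i < N)%N ->
  0 <= \sum_(1 <= j < N) fdcoef alpha mu l N i j.
Proof.
move=> iN.
pose D := \sum_(1 <= d < N) p d.
pose F d := if d is 0 then C * D else - (C * (p d / 2)).
(* F drops from the diagonal entry the two nonnegative terms that match no
   off-diagonal one. *)
apply: (@le_trans _ _ (\sum_(1 <= j < N) F `|i - j|%N)).
  have H n : (n <= N)%N -> \sum_(1 <= d < n) p d <= D.
    case: n => [|n] nN.
      by rewrite big_geq// /D big_nat_cond sumr_ge0// => d /andP[/andP[/p0]].
    rewrite /D [leRHS](@big_cat_nat _ _ _ n.+1)//= lerDl.
    rewrite big_nat_cond sumr_ge0// => d /andP[/andP[nd _] _].
    by apply: p0; apply: leq_trans nd.
  have FE n : \sum_(1 <= d < n) F d = - (C * ((\sum_(1 <= d < n) p d) / 2)).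
    rewrite mulr_suml mulr_sumr -sumrN; apply: eq_big_nat => d /andP[].
    by case: d.
  rewrite sum_dist_split// !FE [F 0%N]/=.
  have h1 := H i (ltnW (proj2 (andP iN))).
  have h2 := H (N - i)%N (leq_subr _ _).
  set x := \sum_(_ <= _ < i) _ in h1 *.
  set y := \sum_(_ <= _ < N - i) _ in h2 *.
  have -> : - (C * (x / 2)) + C * D - (C * (y / 2)) =
      C * ((D - x) / 2 + (D - y) / 2).
    by field.
  by apply: mulr_ge0 => //; apply: addr_ge0; rewrite divr_ge0 ?subr_ge0.
apply: ler_sum_nat => j /andP[j1 jN].
have [<-|ij] := eqVneq i j.
  rewrite distnn /F /fdcoef distnn ler_wpM2l// /D.
  have N2 : (1 < N)%N by case/andP: iN; case: (i) => // k _; exact: leq_trans.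
  have N0 : (0 < N)%N by exact: ltnW.
  rewrite big_ltn// {1}/p eqxx.
  have -> : \sum_(2 <= k < N) p k = \sum_(2 <= k < N) q k.
    by apply: eq_big_nat => -[|[|k]].
  have N1 : 0 <= N%:R - 1 :> R by rewrite subr_ge0 ler1n.
  have /andP[a0 _] := ha.
  have tail0 : 0 <= 2 * nu / (alpha * N%:R `^ alpha).
    by rewrite divr_ge0 ?mulr_ge0 ?powR_ge0// ltW.
  rewrite addrC -[leLHS]addr0 lerD// lerD2r lerDl.
  rewrite divr_ge0 ?powR_ge0// subr_ge0.
  by rewrite ge0_ler_powR ?nnegrE ?(ltW nu0)// lerBlDr lerDl.
rewrite fdcoef_offdiag// /F; case E : `|i - j|%N => [|d]//.
by move: ij; rewrite -distn_eq0 E.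
Qed.

(** Off the diagonal a_ij <= 0 and e_i e_j <= e_i^2, so replacing every e_j by
    e_i lowers the product to e_i^2 times the row sum. *)
Lemma discrete_max_principle (e : nat -> R) i : (0 < i < N)%N ->
  (forall j, (0 < j < N)%N -> `|e j| <= `|e i|) ->
  0 <= e i * discrete_fraclap alpha mu l N e i.
Proof.
move=> iN emax; rewrite /discrete_fraclap mulr_sumr.
apply: (@le_trans _ _ (e i ^+ 2 * \sum_(1 <= j < N) fdcoef alpha mu l N i j)).
  by rewrite mulr_ge0 ?sqr_ge0 ?fdcoef_row_sum_ge0.
rewrite mulr_sumr; apply: ler_sum_nat => j jN.
rewrite [leRHS]mulrCA [leLHS]mulrC.
have [<-|ij] := eqVneq i j; first by rewrite expr2.
rewrite ler_wnM2l ?fdcoef_offdiag_le0//.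
rewrite (le_trans (ler_norm _))// normrM.
rewrite -(real_normK (num_real (e i))) expr2 ler_wpM2l//.
exact: emax.
Qed.

End space.

(** * Stability of the scheme *)

Section stability.
Context {R : realType} (gamma alpha mu T l : R) (r M N Nexp : nat).
Context (s w : 'I_Nexp -> R).

Lemma fast_caputoB (v v' : nat -> R) m :
  fast_caputo gamma T r M s w (fun k => v k - v' k) m =
  fast_caputo gamma T r M s w v m - fast_caputo gamma T r M s w v' m.
Proof.
rewrite /fast_caputo -mulrBr; congr (_ * _).
under eq_bigr do rewrite mulrBr.
by rewrite sumrB; ring.
Qed.

Lemma discrete_fraclapB (v v' : nat -> R) i :
  discrete_fraclap alpha mu l N (fun k => v k - v' k) i =
  discrete_fraclap alpha mu l N v i - discrete_fraclap alpha mu l N v' i.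
Proof.
rewrite /discrete_fraclap; under eq_bigr do rewrite mulrBr.
by rewrite sumrB.
Qed.

(** Induction on the level: at a node where |e^m| is maximal the diffusion term
    only helps, and the history term is a combination of earlier errors with
    nonnegative coefficients telescoping to b_m - b_1; the source supplies the
    missing b_1. *)
Lemma fids_stability (kap rho e : nat -> nat -> R) (K : R) :
  let b := bcoef gamma T r M s w in
  0 < alpha < 2 -> alpha < mu -> 0 < Gamma (1 - gamma) ->
  (forall m k, (0 < k < m)%N -> (m <= M)%N -> b m k <= b m k.+1) ->
  (forall m, (0 < m <= M)%N -> 0 < b m 1%N) ->
  (forall i m, (0 < i < N)%N -> (0 < m <= M)%N -> 0 <= kap i m) ->
  (forall i m, (0 < i < N)%N -> (0 < m <= M)%N ->
     fast_caputo gamma T r M s w (e i) m =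
     - kap i m * discrete_fraclap alpha mu l N (fun j => e j m) i + rho i m) ->
  (forall i, (0 < i < N)%N -> e i 0%N = 0) ->
  0 <= K ->
  (forall i m, (0 < i < N)%N -> (0 < m <= M)%N ->
     Gamma (1 - gamma) * `|rho i m| <= K * b m 1%N) ->
  forall m i, (m <= M)%N -> (0 < i < N)%N -> `|e i m| <= K.
Proof.
move=> b ha hmu G0 bmono b1 kap0 eqn e0 K0 rhoK.
elim/ltn_ind => -[|m] IH i mM iN; first by rewrite e0 ?normr0.
have [i1 /andP[i1N i1max]] : exists i1, (0 < i1 < N)%N &&
    [forall j : 'I_N, (0 < j)%N ==> (`|e j m.+1| <= `|e i1 m.+1|)].
  have /andP[i0 iN'] := iN.
  have [k k0 kmax] := @Order.TotalTheory.arg_maxP _ _ _ (Ordinal iN')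
    (fun j : 'I_N => (0 < j)%N) (fun j : 'I_N => `|e j m.+1|) i0.
  exists k; rewrite k0 ltn_ord/=; apply/forallP => j; apply/implyP; exact: kmax.
have {}i1max j : (0 < j < N)%N -> `|e j m.+1| <= `|e i1 m.+1|.
  by move=> /andP[j0 jN]; have /forallP/(_ (Ordinal jN))/implyP := i1max; apply.
apply: (le_trans (i1max _ iN)).
set x := e i1 m.+1.
have mM' : (0 < m.+1 <= M)%N by [].
have b1m := b1 _ mM'.
have bm : b m.+1 1%N <= b m.+1 m.+1.
  have H k : (k <= m)%N -> b m.+1 1%N <= b m.+1 k.+1.
    elim: k => [|k IHk] km //; apply: (le_trans (IHk (ltnW km))).
    by apply: bmono => //; rewrite ltnS.
  exact: H.
pose S := \sum_(1 <= k < m.+1) (b m.+1 k.+1 - b m.+1 k) * e i1 k.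
have Sle : `|S| <= (b m.+1 m.+1 - b m.+1 1%N) * K.
  rewrite -telescope_sumr// mulr_suml.
  apply: (le_trans (ler_norm_sum _ _ _)); apply: ler_sum_nat => k /andP[k1 km].
  have bk : 0 <= b m.+1 k.+1 - b m.+1 k by rewrite subr_ge0 bmono ?k1.
  rewrite normrM ger0_norm// ler_wpM2l// IH//.
  by apply: leq_trans mM; exact: ltnW.
have maxp := @discrete_max_principle _ _ _ l _ ha hmu
  (fun j => e j m.+1) _ i1N i1max.
set L := discrete_fraclap _ _ _ _ _ _ in maxp.
have E : b m.+1 m.+1 * x = S - Gamma (1 - gamma) * (kap i1 m.+1 * L)
    + Gamma (1 - gamma) * rho i1 m.+1.
  have := eqn _ _ i1N mM'.
  rewrite /fast_caputo e0// mulr0 subr0 -/b -/S -/L -/x.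
  move=> /(congr1 (fun z => Gamma (1 - gamma) * z)).
  rewrite mulVKf ?gt_eqF// => /eqP; rewrite subr_eq => /eqP ->; ring.
(* |x| <= K is proved after multiplication by b_m |x|, with b_m |x|^2 = b_m x^2
   expanded by E. *)
have [x0|x0] := eqVneq x 0; first by rewrite x0 normr0.
have bm0 : 0 < b m.+1 m.+1 by exact: lt_le_trans bm.
have nx0 : 0 < `|x| by rewrite normr_gt0.
rewrite -(ler_pM2l (mulr_gt0 bm0 nx0)) -[leLHS]mulrA -expr2.
rewrite real_normK ?num_real// expr2 mulrA E.
have GkL : 0 <= Gamma (1 - gamma) * kap i1 m.+1 * (x * L).
  by apply: mulr_ge0 => //; apply: mulr_ge0; [exact: ltW|exact: kap0].
have rK := rhoK _ _ i1N mM'.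
have rx : Gamma (1 - gamma) * rho i1 m.+1 * x <= K * b m.+1 1%N * `|x|.
  apply: (le_trans (ler_norm _)); rewrite !normrM (gtr0_norm G0).
  by rewrite ler_wpM2r.
have Sx : S * x <= (b m.+1 m.+1 - b m.+1 1%N) * K * `|x|.
  by apply: (le_trans (ler_norm _)); rewrite normrM ler_wpM2r.
by move: GkL rx Sx; lra.
Qed.

End stability.

(** * Convergence *)

(** With t_j^gamma = T^gamma (j / M)^(r gamma) and
    a' = min (r gamma) (2 - gamma): both exponents may be lowered to a', since
    j >= 1 and j / M <= 1, and j^(-a') (j / M)^a' = M^(-a'). *)
Lemma truncation_weight_le (R : realType) (gamma T : R) (r M j : nat) :
  0 < gamma < 1 -> 0 < T -> (0 < j <= M)%N ->
  j%:R `^ (- Num.min (r%:R * (1 + gamma)) (2 - gamma)) * tnode T r M j `^ gamma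
  <= T `^ gamma * M%:R `^ (- Num.min (r%:R * gamma) (2 - gamma)).
Proof.
move=> /andP[g0 g1] T0 /andP[j0 jM].
set a := Num.min _ _; set a' := Num.min _ _.
have j0' : 0 < j%:R :> R by rewrite ltr0n.
have M0 : 0 < M%:R :> R by rewrite ltr0n (leq_trans j0).
have a'a : a' <= a.
  rewrite /a le_min; apply/andP; split; last by rewrite ge_min lexx orbT.
  by rewrite (@le_trans _ _ (r%:R * gamma))// ?ge_min ?lexx// ler_wpM2l// lerDr.
have -> : tnode T r M j `^ gamma = (j%:R / M%:R) `^ (r%:R * gamma) * T `^ gamma.
  rewrite /tnode powRM ?exprn_ge0 ?divr_ge0 ?ltW//.
  by rewrite -powR_mulrn ?divr_ge0// -powRrM.
rewrite mulrA mulrC ler_wpM2l ?powR_ge0//.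
apply: (@le_trans _ _ (j%:R `^ (- a') * (j%:R / M%:R) `^ a')).
  apply: ler_pM; rewrite ?powR_ge0//.
    by apply: ler_powR; rewrite ?ler1n// lerN2.
  apply: ger_powR; last by rewrite ge_min lexx.
  by rewrite divr_gt0//= ler_pdivrMr// mul1r ler_nat.
have jn0 : j%:R != 0 :> R by rewrite gt_eqF.
rewrite powRM ?invr_ge0// mulrA -powRD ?jn0 ?implybT//.
rewrite addNr powRr0 mul1r.
by rewrite -powR_inv1// -powRrM mulN1r.
Qed.

Lemma xnode_int (R : realType) (l : R) (N i : nat) : 0 < l -> (0 < i < N)%N ->
  - l < xnode l N i < l.
Proof.
move=> l0 /andP[i0 iN].
have N0 : 0 < N%:R :> R by rewrite ltr0n (leq_trans i0)// ltnW.
have h0 : 0 < 2 * l / N%:R by rewrite divr_gt0 ?mulr_gt0.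
rewrite /xnode /xstep ltrDl mulr_gt0 ?ltr0n//=.
have -> : i%:R * (2 * l / N%:R) = 2 * l * (i%:R / N%:R) by ring.
have : i%:R / N%:R < 1 :> R by rewrite ltr_pdivrMr// mul1r ltr_nat.
by rewrite -(ltr_pM2l l0) mulr1; lra.
Qed.

Lemma xnodeN (R : realType) (l : R) (N : nat) : (0 < N)%N -> xnode l N N = l.
Proof.
move=> N0; have N0' : N%:R != 0 :> R by rewrite pnatr_eq0 -lt0n.
by rewrite /xnode /xstep; field.
Qed.

Theorem theorem2p4 (R : realType) (gamma T : R) (r : nat)
    (hgamma : 0 < gamma < 1) (hT : 0 < T) (hr : (0 < r)%N) :
  exists2 c1 : R, 0 < c1 &
  forall (alpha l mu : R) (kappa f : R -> R -> R) (phi : R -> R)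
    (u : R -> R -> R) (c0 c2 p : R),
    0 < alpha < 2 ->
    0 < l ->
    alpha < mu <= 2 ->
    (forall x t, - l < x < l -> 0 < t <= T -> 0 < kappa x t) ->
    diffusion_solution gamma alpha T l kappa f phi u ->
    0 < c0 ->
    time_regular gamma T l c0 u ->
    0 < c2 ->
    0 < p <= 2 ->
  forall (M N Nexp : nat) (eps : R) (s w : 'I_Nexp -> R)
    (v : nat -> nat -> R),
    (0 < M)%N ->
    (0 < N)%N ->
    0 < eps ->
    soe_approx gamma T r M eps s w ->
    (forall i m, (1 <= i < N)%N -> (1 <= m <= M)%N ->
       `|trunc_error gamma alpha mu T l r M N s w kappa f u i m|
         <= c2 * (m%:R `^ (- Num.min (r%:R * (1 + gamma)) (2 - gamma))
                  + xstep l N `^ p + eps)) ->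
    fids_solution gamma alpha mu T l r M N s w kappa f phi v ->
    eps <= Num.min (c1 * M%:R `^ gamma) (2^-1 * T `^ (- gamma)) ->
  forall m, (1 <= m <= M)%N ->
    max_norm N (fun i => grid_restr T l r M N u i m - v i m)
      <= 2 * Gamma (1 - gamma) * c2 * T `^ gamma
         * (M%:R `^ (- Num.min (r%:R * gamma) (2 - gamma))
            + xstep l N `^ p + eps).
Proof.
have /andP[g0 g1] := hgamma.
exists (gamma / (1 - gamma) * (r%:R * T) `^ (- gamma)).
  by rewrite !mulr_gt0 ?invr_gt0 ?powR_gt0 ?mulr_gt0 ?subr_gt0 ?ltr0n.
move=> alpha l mu kappa f phi u c0 c2 p ha l0 /andP[hmu _] kap0.
move=> [_ ubc uinit] _ _ c20 _ M N Nexp eps s w v M0 N0 eps0 hsoe htrunc.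
move=> [vscheme vbc vinit].
rewrite le_min => /andP[epsM epsT] m /andP[m0 mM].
set h := xstep l N; set q' := Num.min (r%:R * gamma) _.
have G0 : 0 < Gamma (1 - gamma).
  by apply: Gamma_gt0; rewrite subr_gt0 g1 gtrBl.
set K : R := _ * (_ + _).
have B0 : 0 <= M%:R `^ (- q') + h `^ p + eps.
  by rewrite !addr_ge0 ?powR_ge0 ?ltW.
have K0 : 0 <= K by rewrite !mulr_ge0 ?powR_ge0 ?(ltW G0) ?(ltW c20).
have tT k : (0 < k <= M)%N -> 0 < tnode T r M k <= T.
  by move=> /[dup]/andP[k0 _] kM; rewrite tnode_gt0//=;
    have /andP[] := tnode_itv hT hr M0 kM.
have tT' k : (k <= M)%N -> 0 <= tnode T r M k <= T.
  case: k => [|k] kM; first by rewrite tnode0// lexx ltW.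
  by have /andP[/ltW -> ->] := tT k.+1 kM.
apply: bigmax_le => // -[i /= iN] _.
have ubc0 x k : (k <= M)%N -> ~~ (- l < x < l) -> u x (tnode T r M k) = 0.
  by move=> kM xl; apply: ubc => //; exact: tT'.
have [v0 vN] := vbc m mM.
have [->|i0] := posnP i.
  by rewrite v0 subr0 /grid_restr /xnode mul0r addr0 ubc0 ?normr0// ltxx.
have [iN'|Ni] := ltnP i N; last first.
  have -> : i = N by apply/eqP; rewrite eqn_leq Ni andbT.
  by rewrite vN subr0 /grid_restr xnodeN// ubc0 ?normr0// ltxx andbF.
pose e i m := grid_restr T l r M N u i m - v i m.
rewrite -/(e i m).
apply: (@fids_stability _ gamma alpha mu T l r M N Nexp s w
  (fun i m => kappa (xnode l N i) (tnode T r M m))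
  (trunc_error gamma alpha mu T l r M N s w kappa f u)) => //.
- by move=> m' k km m'M; exact: (bcoef_nondecreasing hgamma hT hr M0 hsoe).
- move=> k kM; apply: lt_le_trans (bcoef1_ge hgamma hT hr M0 hsoe epsT kM).
  by rewrite mulr_gt0 ?invr_gt0// powR_gt0//; case/andP: (tT k kM).
- by move=> j k jN kM; apply/ltW/kap0; [exact: xnode_int|exact: tT].
- move=> j k jN kM; rewrite fast_caputoB discrete_fraclapB vscheme//.
  by rewrite /trunc_error; ring.
- move=> j jN; rewrite /e /grid_restr vinit// tnode0// uinit ?subrr//.
  exact: xnode_int.
- move=> j k jN kM; have := htrunc j k jN kM.
  set rho := `|_|; set b := bcoef _ _ _ _ _ _ _ _.
  have : 2^-1 * tnode T r M k `^ (- gamma) <= b.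
    exact: (bcoef1_ge hgamma hT hr M0 hsoe epsT kM).
  have /andP[tk0 tkT] := tT k kM.
  have := truncation_weight_le r hgamma hT kM.
  rewrite -/q' -/h.
  set a := k%:R `^ _; set t := tnode T r M k => aq bge rhole.
  have tg0 : 0 < t `^ gamma by rewrite powR_gt0.
  apply: (@le_trans _ _ (K * (2^-1 * t `^ (- gamma)))); last first.
    by rewrite ler_wpM2l.
  have tgT : t `^ gamma <= T `^ gamma.
    by rewrite ge0_ler_powR ?nnegrE ?(ltW g0) ?(ltW tk0) ?(ltW hT).
  have key : (a + h `^ p + eps) * t `^ gamma <=
      T `^ gamma * (M%:R `^ (- q') + h `^ p + eps).
    rewrite -addrA mulrDl -[in leRHS]addrA mulrDr lerD// mulrC ler_wpM2r//.
    by rewrite addr_ge0 ?powR_ge0 ?ltW.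
  have -> : K * (2^-1 * t `^ (- gamma)) = Gamma (1 - gamma) *
     (c2 * (T `^ gamma * (M%:R `^ (- q') + h `^ p + eps) / t `^ gamma)).
    by rewrite powRN /K; field; rewrite gt_eqF.
  rewrite ler_wpM2l ?(ltW G0)//; apply: (le_trans rhole).
  by rewrite ler_wpM2l ?(ltW c20)// ler_pdivlMr.
- by rewrite i0.
Qed.
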